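(* For every integer $n\ge 5$, the second twist number of $W(3,n)$ is $T_2(W(3,n))=n(n-1)$.
   Context: $B_3$ denotes the braid group on three strands with standard generators $\sigma_1,\sigma_2$. $W(3,n)$ is the weaving knot (or link, if $3\mid n$) obtained as the closure of the braid $(\sigma_1\sigma_2^{-1})^n\in B_3$, with all strands oriented in the same direction along the braid. $V_K(t)$ denotes the Jones polynomial, normalized by $V_{\text{unknot}}(t)=1$ and satisfying the skein relation $t^{-1}V_{L_+}-tV_{L_-}=(t^{1/2}-t^{-1/2})V_{L_0}$. If $V_K(t)=\lambda_{-m}t^{-m}+\lambda_{-m+1}t^{-m+1}+\cdots+\lambda_{r-1}t^{r-1}+\lambda_r t^r$ with $\lambda_{-m}\neq 0$ and $\lambda_r\ne 0$, then the $j$th twist number of $K$ is $T_j(K)=|\lambda_{-m+j}|+|\lambda_{r-j}|$. For $K=W(3,n)$ the Jones polynomial has lowest exponent $-n$ and highest exponent $n$ (i.e. $m=r=n$). *)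

(* Defs.v *)
From HB Require Import structures.
From mathcomp Require Import all_boot all_order all_algebra.

Set Implicit Arguments.
Unset Strict Implicit.
Unset Printing Implicit Defensive.

Import Order.TTheory GRing.Theory Num.Theory.
Local Open Scope ring_scope.

(** * Oriented links as closed braids

  A word in the generators of the braid group [B_(k+1)] on [k.+1] strands:
  for [i : 'I_k], the letter [(i, true)] is [sigma_(i+1)] and [(i, false)] is
  its inverse. All strands are oriented in the direction of the braid, and
  [sigma_(i+1)] is a positive crossing. *)

Definition letter (k : nat) : Type := 'I_k * bool.
Definition braid_word (k : nat) : Type := seq (letter k).

(* The inclusion of B_(k+1) into B_(k+2) adding one strand on the right. *)
Definition add_strand (k : nat) (w : braid_word k) : braid_word k.+1 :=
  [seq (widen_ord (leqnSn k) l.1, l.2) | l : letter k <- w].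

(* The defining relations of B_(k+1). *)
Inductive braid_relation (k : nat) : braid_word k -> braid_word k -> Prop :=
| braid_cancel (i : 'I_k) (b : bool) :
    braid_relation [:: (i, b); (i, ~~ b)] [::]
| braid_commute (i j : 'I_k) : (i.+1 < j)%N ->
    braid_relation [:: (i, true); (j, true)] [:: (j, true); (i, true)]
| braid_yang_baxter (i j : 'I_k) : j = i.+1 :> nat ->
    braid_relation [:: (i, true); (j, true); (i, true)]
                   [:: (j, true); (i, true); (j, true)].

(* By Alexander's theorem every oriented link is the closure of a braid. *)
Definition closed_braid : Type := {k : nat & braid_word k}.
Definition braid_closure (k : nat) (w : braid_word k) : closed_braid :=
  Tagged braid_word w.

(* By Markov's theorem two closed braids are isotopic as oriented links if and
   only if they are related by braid relations, conjugation (here: cyclic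
   rotation of the word) and stabilization. *)
Inductive isotopic : closed_braid -> closed_braid -> Prop :=
| isotopic_refl (K : closed_braid) : isotopic K K
| isotopic_sym (K L : closed_braid) : isotopic K L -> isotopic L K
| isotopic_trans (K L M : closed_braid) :
    isotopic K L -> isotopic L M -> isotopic K M
| isotopic_braid (k : nat) (u a b v : braid_word k) : braid_relation a b ->
    isotopic (braid_closure (u ++ a ++ v)) (braid_closure (u ++ b ++ v))
| isotopic_conj (k : nat) (u v : braid_word k) :
    isotopic (braid_closure (u ++ v)) (braid_closure (v ++ u))
| isotopic_stab (k : nat) (w : braid_word k) (b : bool) :
    isotopic (braid_closure w) (braid_closure (rcons (add_strand w) (ord_max, b))).

(* The closure of the trivial one-strand braid. *)
Definition unknot : closed_braid := braid_closure ([::] : braid_word 0).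

(* W(3,n) is the closure of (sigma_1 sigma_2^-1)^n in B_3. *)
Definition weaving_knot (n : nat) : closed_braid :=
  braid_closure (flatten (nseq n [:: (ord0 : 'I_2, true); (ord_max : 'I_2, false)])).

(** * The Jones polynomial

  Laurent polynomials in [t^(1/2)] are viewed inside the field of fractions of
  [Z[t^(1/2)]], whose variable ['X] stands for [t^(1/2)]. *)

Definition jones_field : fieldType := {fraction {poly int}}.
Definition sqrt_t : jones_field := tofrac ('X : {poly int}).
Definition var_t : jones_field := sqrt_t ^+ 2.

(* Every crossing change is realized, up to isotopy, at a letter of a closed
   braid, so the skein relation is stated at a letter of a word. These
   conditions determine V uniquely on all closed braids. *)
Record is_jones_polynomial (V : closed_braid -> jones_field) : Prop := {
  jones_isotopic : forall K L : closed_braid, isotopic K L -> V K = V L;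
  jones_unknot : V unknot = 1;
  jones_skein : forall (k : nat) (u v : braid_word k) (i : 'I_k),
    var_t^-1 * V (braid_closure (u ++ (i, true) :: v))
      - var_t * V (braid_closure (u ++ (i, false) :: v))
    = (sqrt_t - sqrt_t^-1) * V (braid_closure (u ++ v))
}.

(** * Twist numbers *)

(* [f] is the sum of [lam j * t^j] over [- m <= j <= r], with nonzero extreme
   coefficients; [lam] is extended by 0 outside of this range. *)
Record laurent_expansion (f : jones_field) (m r : int) (lam : int -> int) :
    Prop := {
  laurent_le : - m <= r;
  laurent_out : forall j : int, ~~ (- m <= j <= r) -> lam j = 0;
  laurent_low : lam (- m) != 0;
  laurent_high : lam r != 0;
  laurent_sum :
    f = \sum_(i < (absz (r + m)).+1) (lam (i%:Z - m))%:~R * var_t ^ (i%:Z - m)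
}.

(* [T] is the [j]-th twist number of a link with Jones polynomial [f]. *)
Definition is_twist_number (f : jones_field) (j T : nat) : Prop :=
  exists (m r : int) (lam : int -> int), laurent_expansion f m r lam /\
    T = (absz (lam (- m + j%:Z)%R) + absz (lam (r - j%:Z)%R))%N.

(* Main.v *)
Require Import Defs.
From mathcomp Require Import all_boot all_order all_algebra.
From mathcomp Require Import ring zify.

(** Write [a, b] for the generators of the 3-strand braid group, [z] for
  [t^(1/2) - t^(-1/2)] and [V_n] for the Jones polynomial of the closure of
  [(a b^-1)^n]. Expanding [b^-1] in [a b^-1 a] and [a^-1] in [b a^-1 b] by the
  skein relation, and using [aba = bab], gives
  [a b^-1 a - b a^-1 b = - z^2 (a - b)] inside any braid, whence
  [V_(n+3) = V_n - z^2 (V_(n+2) - V_(n+1))]. As [- z^2 = tau + 1] with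
  [tau = 1 - t - t^-1], the solution is [V_n = t + t^-1 + T_n], where
  [T_(n+2) = tau T_(n+1) - T_n] is the trace of the [n]-th power of a matrix of
  trace [tau] and determinant 1. The coefficients of [T_n] are symmetric under
  [t -> t^-1], and its three leading ones are [(-1)^n] times [1], [- n] and
  [n (n - 1) / 2]; for [n >= 4] the terms [t + t^-1] do not meet them. *)

Set Implicit Arguments.
Unset Strict Implicit.
Unset Printing Implicit Defensive.

Import Order.TTheory GRing.Theory Num.Theory.

Section TwistNumber.

Local Open Scope ring_scope.

(** * Algebra of the skein relation *)

Lemma sqrt_t_neq0 : sqrt_t != 0.
Proof. by rewrite /sqrt_t tofrac_eq0 polyX_eq0. Qed.

Lemma sqrt_t_subV_neq0 : sqrt_t - sqrt_t^-1 != 0.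
Proof.
rewrite subr_eq0; apply/negP => /eqP h.
have : (tofrac ('X^2 - 1 : {poly int})) == 0.
  by rewrite rmorphB rmorphXn rmorph1 /= -/sqrt_t expr2 {2}h divff ?sqrt_t_neq0 // subrr.
by rewrite tofrac_eq0 -size_poly_eq0 size_XnsubC.
Qed.

Lemma var_t_neq0 : var_t != 0.
Proof. by rewrite expf_neq0 ?sqrt_t_neq0. Qed.

(* [aB] and [bA] stand for the values at [a b^-1 a] and [b a^-1 b], and [e] for
   the value at the empty word, all inside a fixed braid. *)
Lemma skein_exchange (F : fieldType) (s aba bab aa bb a b e aB bA : F) :
    s != 0 -> aba = bab ->
    (s ^+ 2)^-1 * aba - s ^+ 2 * aB = (s - s^-1) * aa ->
    (s ^+ 2)^-1 * bab - s ^+ 2 * bA = (s - s^-1) * bb ->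
    (s ^+ 2)^-1 * aa - s ^+ 2 * e = (s - s^-1) * a ->
    (s ^+ 2)^-1 * bb - s ^+ 2 * e = (s - s^-1) * b ->
  aB - bA = - (s - s^-1) ^+ 2 * (a - b).
Proof.
move=> s0 -> h1 h2 h3 h4.
have t0 : s ^+ 2 != 0 by rewrite expf_neq0.
apply: (mulfI t0).
have -> : s ^+ 2 * (aB - bA) = - (s - s^-1) * (aa - bb).
  by rewrite mulrBr mulNr mulrBr -h1 -h2; ring.
have -> : aa - bb = s ^+ 2 * (s - s^-1) * (a - b).
  by rewrite -mulrA [_ * (a - b)]mulrBr -h3 -h4; field.
ring.
Qed.

Lemma split_unlink_value (F : fieldType) (s d : F) : s != 0 -> s - s^-1 != 0 ->
  forall c, (s ^+ 2)^-1 * c - s ^+ 2 * c = (s - s^-1) * d ->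
  d = - (s + s^-1) * c.
Proof. by move=> s0 z0 c h; apply: (mulfI z0); rewrite -h; field. Qed.

Local Notation g1 := (ord0 : 'I_2).
Local Notation g2 := (ord_max : 'I_2).

Definition weaving_word (n : nat) : braid_word 2 :=
  flatten (nseq n [:: (g1, true); (g2, false)]).

(** * Jones polynomials of closed 3-braids *)

Section JonesWeaving.

Context (V : closed_braid -> jones_field) (hV : is_jones_polynomial V).

Let V3 (w : braid_word 2) := V (braid_closure w).
Let s := sqrt_t.

Lemma jones_relation (k : nat) (u a b v : braid_word k) : braid_relation a b ->
  V (braid_closure (u ++ a ++ v)) = V (braid_closure (u ++ b ++ v)).
Proof. by move=> h; apply: (jones_isotopic hV); apply: isotopic_braid. Qed.

Lemma jones_cancel (k : nat) (u v : braid_word k) i b :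
  V (braid_closure (u ++ (i, b) :: (i, ~~ b) :: v)) = V (braid_closure (u ++ v)).
Proof. exact: jones_relation u _ _ v (braid_cancel i b). Qed.

Lemma jones_stab (k : nat) (w : braid_word k) b :
  V (braid_closure (rcons (add_strand w) (ord_max, b))) = V (braid_closure w).
Proof. by apply/esym/(jones_isotopic hV)/isotopic_stab. Qed.

(** Apply the skein relation at a crossing with the new strand: both signs are stabilizations of
    [w], so both have its value. *)
Lemma jones_split_unlink (k : nat) (w : braid_word k) :
  V (braid_closure (add_strand w)) = - (s + s^-1) * V (braid_closure w).
Proof.
apply: split_unlink_value sqrt_t_neq0 sqrt_t_subV_neq0 _ _.
have := jones_skein hV (add_strand w) [::] ord_max.
by rewrite !cats1 !jones_stab cats0.
Qed.

Lemma jones_exchange (v : braid_word 2) :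
  V3 [:: (g1, true), (g2, false), (g1, true) & v]
    - V3 [:: (g2, true), (g1, false), (g2, true) & v]
  = - (s - s^-1) ^+ 2 * (V3 ((g1, true) :: v) - V3 ((g2, true) :: v)).
Proof.
apply: (skein_exchange sqrt_t_neq0
  (jones_relation [::] v (@braid_yang_baxter 2 g1 g2 erefl))
  (jones_skein hV [:: (g1, true)] ((g1, true) :: v) g2)
  (jones_skein hV [:: (g2, true)] ((g2, true) :: v) g1)
  (e := V3 v)).
- have := jones_skein hV [::] ((g1, true) :: v) g1.
  by rewrite (jones_cancel [::] v g1 false).
- have := jones_skein hV [::] ((g2, true) :: v) g2.
  by rewrite (jones_cancel [::] v g2 false).
Qed.

Lemma jones_weaving0 : V3 (weaving_word 0) = (s + s^-1) ^+ 2.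
Proof.
rewrite /V3 -[weaving_word 0]/(add_strand (add_strand ([::] : braid_word 0))).
by rewrite !jones_split_unlink (jones_unknot hV); ring.
Qed.

(** Two stabilizations of the trivial one-strand braid. *)
Lemma jones_two_stab b c : V3 [:: (g1, b); (g2, c)] = 1.
Proof.
rewrite -(jones_unknot hV) -(jones_stab ([::] : braid_word 0) b).
rewrite -(jones_stab _ c) /V3 /=; congr (V (braid_closure [:: (_, _); _])).
exact: val_inj.
Qed.

Lemma jones_weaving2 :
  V3 (weaving_word 2) = 1 - (s - s^-1) ^+ 2 * (1 - (s + s^-1) ^+ 2).
Proof.
(* Appending [b^-1] turns [a b^-1 a] into the weaving word, [b a^-1 b] into an unknot, and [b] into
   the three-component unlink. *)
have := jones_exchange [:: (g2, false)].
rewrite /V3 (jones_cancel [:: (g2, true); (g1, false)] [::] g2 true).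
rewrite (jones_cancel [::] [::] g2 true) -[[::] ++ [::]]/(weaving_word 0).
rewrite -!/(V3 _) jones_weaving0 jones_two_stab.
have -> : V3 ([:: (g2, true); (g1, false)] ++ [::]) = 1.
  rewrite -(jones_two_stab false true); apply: (jones_isotopic hV).
  exact: isotopic_conj [:: (g2, true)] [:: (g1, false)].
by move=> /(canRL (subrK _)) ->; ring.
Qed.

Lemma jones_weaving_rec n :
  V3 (weaving_word n.+3) = V3 (weaving_word n)
    - (s - s^-1) ^+ 2 * (V3 (weaving_word n.+2) - V3 (weaving_word n.+1)).
Proof.
(* After [b a^-1 b], this tail cancels letter by letter and leaves [weaving_word n]. *)
have := jones_exchange ((g2, false) :: weaving_word n.+1).
rewrite /V3 (jones_cancel [:: (g2, true); (g1, false)] (weaving_word n.+1) g2 true).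
rewrite (jones_cancel [::] (weaving_word n.+1) g2 true).
rewrite (jones_cancel [:: (g2, true)] ((g2, false) :: weaving_word n) g1 false).
rewrite (jones_cancel [::] (weaving_word n) g2 true) /=.
by move=> /(canRL (subrK _)) ->; rewrite mulNr addrC.
Qed.

End JonesWeaving.

(** * Coefficients of the traces *)

(* The coefficient of [t^j] in [T_n]. *)
Fixpoint trace_coef (n : nat) (j : int) : int :=
  match n with
  | 0 => 2 * (j == 0)%:R
  | m.+1 =>
    match m with
    | 0 => (j == 0)%:R - (j == 1)%:R - (j == - 1)%:R
    | k.+1 => trace_coef m j - trace_coef m (j - 1) - trace_coef m (j + 1)
                - trace_coef k j
    end
  end.

Lemma trace_coefSS n j :
  trace_coef n.+2 j = trace_coef n.+1 j - trace_coef n.+1 (j - 1)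
    - trace_coef n.+1 (j + 1) - trace_coef n j.
Proof. by []. Qed.

Lemma two_step_ind (P : nat -> Prop) : P 0%N -> P 1%N ->
  (forall n, P n -> P n.+1 -> P n.+2) -> forall n, P n.
Proof.
move=> P0 P1 PS n; suff [] : P n /\ P n.+1 by [].
by elim: n => [|n [h1 h2]]; split=> //; apply: PS.
Qed.

Lemma trace_coefN n j : trace_coef n (- j) = trace_coef n j.
Proof.
elim/two_step_ind: n j => [||n h1 h2] j.
- by rewrite /= oppr_eq0.
- by rewrite /= oppr_eq0 !eqr_oppLR opprK addrAC.
- rewrite !trace_coefSS h1 h2 -opprD h2 -(h2 (- j + 1)) opprD opprK; ring.
Qed.

Lemma trace_coef_eq0 n (j : int) : n%:Z < j -> trace_coef n j = 0.
Proof.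
elim/two_step_ind: n j => [||n h1 h2] j lt_nj.
- by rewrite /=; case: eqP => [?|_]; [lia | rewrite mulr0].
- by rewrite /=; do 3![case: eqP => [?|_]; first lia]; rewrite !subr0.
- by rewrite trace_coefSS h1 ?h2 //; lia.
Qed.

(** Only the term at [j - 1] reaches the top degree. The index starts at 1 because [T_0 = 2]. *)
Lemma trace_coef_top n : trace_coef n.+1 n.+1 = (- 1) ^+ n.+1.
Proof.
elim: n => // n IH; rewrite trace_coefSS (_ : n.+2%:Z - 1 = n.+1); last lia.
by rewrite [RHS]exprS mulN1r IH !trace_coef_eq0 ?sub0r ?subr0 //; lia.
Qed.

Lemma trace_coef_top1 n : trace_coef n.+1 n = - (- 1) ^+ n.+1 * n.+1%:R.
Proof.
elim: n => // n IH; rewrite trace_coefSS trace_coef_top.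
rewrite (_ : n.+1%:Z - 1 = n) ?IH; last lia.
rewrite (trace_coef_eq0 (n := n.+1)) ?(trace_coef_eq0 (n := n)); try lia.
by rewrite !exprS -[in RHS]natr1; move: ((-1) ^+ n) => e; ring.
Qed.

(** In the recursion the two leading coefficients cancel each other; the rest is Pascal's rule. *)
Lemma trace_coef_top2 n : trace_coef n.+2 n = (- 1) ^+ n * 'C(n.+2, 2)%:R.
Proof.
elim: n => // n IH; rewrite trace_coefSS trace_coef_top trace_coef_top1.
rewrite (_ : n.+1%:Z - 1 = n) ?IH; last lia.
rewrite (_ : n.+1%:Z + 1 = n.+2) ?trace_coef_top; last lia.
by rewrite [in RHS]binS bin1 natrD !exprS; move: ((-1) ^+ n) => e; ring.
Qed.

(** * Evaluation of Laurent polynomials on a window *)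

Section LaurentSum.

Context (F : fieldType) (t : F).

(* All [T_n] with [n <= N] are evaluated on the common window [- N <= j <= N],
   so that their recursion becomes linear in [laurent_eval]. *)
Definition laurent_eval (N : nat) (c : int -> int) : F :=
  \sum_(i < (N + N).+1) (c (i%:Z - N%:Z))%:~R * t ^ (i%:Z - N%:Z).

Lemma eq_laurent_eval N c d : c =1 d -> laurent_eval N c = laurent_eval N d.
Proof. by move=> cd; apply: eq_bigr => i _; rewrite cd. Qed.

Lemma laurent_evalD N c d :
  laurent_eval N (fun j => c j + d j) = laurent_eval N c + laurent_eval N d.
Proof. by rewrite -big_split; apply: eq_bigr => i _; rewrite intrD mulrDl. Qed.

Lemma laurent_evalM N (a : int) c :
  laurent_eval N (fun j => a * c j) = a%:~R * laurent_eval N c.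
Proof. by rewrite mulr_sumr; apply: eq_bigr => i _; rewrite intrM mulrA. Qed.

Lemma laurent_evalB N c d :
  laurent_eval N (fun j => c j - d j) = laurent_eval N c - laurent_eval N d.
Proof. by rewrite -sumrB; apply: eq_bigr => i _; rewrite rmorphB mulrBl. Qed.

Lemma laurent_eval_delta N (k : int) : `|k| <= N%:Z ->
  laurent_eval N (fun j => (j == k)%:R) = t ^ k.
Proof.
move=> hk; have lt_k : (absz (k + N%:Z)%R < (N + N).+1)%N by lia.
rewrite /laurent_eval (bigD1 (Ordinal lt_k)) //= big1 => [|i /eqP ne_ik].
  by rewrite (_ : (absz (k + N%:Z))%:Z - N%:Z = k) ?eqxx ?mul1r ?addr0 //; lia.
rewrite (_ : (_ == k) = false) ?mul0r //; apply/negP => /eqP hi; apply: ne_ik.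
by apply: val_inj => /=; lia.
Qed.

Lemma laurent_eval_trace0 N : laurent_eval N (trace_coef 0) = 2.
Proof.
rewrite (@laurent_evalM N 2 (fun j => (j == 0)%:R)) laurent_eval_delta ?normr0 //.
by rewrite expr0z mulr1.
Qed.

Lemma laurent_eval_trace1 N : (0 < N)%N ->
  laurent_eval N (trace_coef 1) = 1 - t - t^-1.
Proof.
move=> N0; rewrite 2!laurent_evalB !laurent_eval_delta; try lia.
by rewrite expr0z expr1z -exprN1.
Qed.

Context (t0 : t != 0).

(** The two hypotheses concern the coefficient that enters the window on the left and the one that
    leaves it on the right. *)
Lemma laurent_eval_shift N (c : int -> int) : c (- N%:Z - 1) = 0 -> c N = 0 ->
  laurent_eval N (fun j => c (j - 1)) = t * laurent_eval N c.
Proof.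
move=> cl cr; rewrite /laurent_eval big_ord_recl big_ord_recr /= sub0r cl.
rewrite mul0r add0r (_ : (N + N)%N%:Z - N%:Z = N) ?cr; last lia.
rewrite mul0r addr0 mulr_sumr; apply: eq_bigr => i _ /=.
rewrite (_ : (bump 0 i)%:Z - N%:Z = i%:Z - N%:Z + 1); last by rewrite /bump; lia.
by rewrite addrK expfzDr // expr1z mulrA mulrC mulrA.
Qed.

Lemma laurent_eval_shiftV N (c : int -> int) : c (- N%:Z) = 0 -> c (N%:Z + 1) = 0 ->
  laurent_eval N (fun j => c (j + 1)) = t^-1 * laurent_eval N c.
Proof.
move=> cl cr; apply: (mulfI t0); rewrite mulVKf //.
rewrite -(@laurent_eval_shift N (fun j => c (j + 1))) ?subrK //.
by apply: eq_laurent_eval => j; rewrite subrK.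
Qed.

Lemma laurent_eval_traceSS N n : (n.+2 <= N)%N ->
  laurent_eval N (trace_coef n.+2) =
    (1 - t - t^-1) * laurent_eval N (trace_coef n.+1)
      - laurent_eval N (trace_coef n).
Proof.
move=> nN; rewrite (eq_laurent_eval _ (trace_coefSS n)).
(* As [n.+2 <= N], this covers all boundary coefficients in both shifts. *)
have v (j : int) : n.+1%:Z < `|j| -> trace_coef n.+1 j = 0.
  by move=> hj; case: (lerP 0 j) => j0; [|rewrite -trace_coefN];
    apply: trace_coef_eq0; lia.
rewrite !laurent_evalB laurent_eval_shift ?laurent_eval_shiftV ?v; try lia.
ring.
Qed.

End LaurentSum.

(** The characteristic polynomial is [(x - 1) (x^2 - tau x + 1)]: the root 1 yields the constant
    [t + t^-1], the other factor yields [T_n]. *)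
Lemma weaving_rec_solution (F : fieldType) (s : F) (v : nat -> F) : s != 0 ->
    v 0%N = (s + s^-1) ^+ 2 -> v 1%N = 1 ->
    v 2%N = 1 - (s - s^-1) ^+ 2 * (1 - (s + s^-1) ^+ 2) ->
    (forall n, v n.+3 = v n - (s - s^-1) ^+ 2 * (v n.+2 - v n.+1)) ->
  forall N n : nat, (0 < N)%N -> (n <= N)%N ->
  v n = s ^+ 2 + (s ^+ 2)^-1 + laurent_eval (s ^+ 2) N (trace_coef n).
Proof.
move=> s0 v0 v1 v2 vS N n N0.
have t0 : s ^+ 2 != 0 by rewrite expf_neq0.
have tr1 := laurent_eval_trace1 (s ^+ 2) N0.
have trSS := @laurent_eval_traceSS _ _ t0 N.
have [m le_nm] := ubnP n; elim: m n le_nm => // m IH [|[|[|n]]] lt_nm nN.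
- by rewrite v0 laurent_eval_trace0; field.
- by rewrite v1 tr1; field.
- by rewrite v2 trSS // tr1 laurent_eval_trace0; field.
have -> : v n.+3 = v n + (2 - s ^+ 2 - (s ^+ 2)^-1) * (v n.+2 - v n.+1).
  by rewrite vS; field.
by rewrite !IH ?(trSS n.+1) ?(trSS n) //; try lia; field.
Qed.

Lemma jones_weaving V (hV : is_jones_polynomial V) (N n : nat) :
  (0 < N)%N -> (n <= N)%N ->
  V (weaving_knot n) = var_t + var_t^-1 + laurent_eval var_t N (trace_coef n).
Proof.
exact: (weaving_rec_solution (v := fun n => V (weaving_knot n)) sqrt_t_neq0
  (jones_weaving0 hV) (jones_two_stab hV _ _) (jones_weaving2 hV)
  (jones_weaving_rec hV)).
Qed.

(** * Extreme coefficients of the Jones polynomial *)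

Definition weaving_coef (n : nat) (j : int) : int :=
  (j == 1)%:R + (j == - 1)%:R + trace_coef n j.

Lemma weaving_coefN n j : weaving_coef n (- j) = weaving_coef n j.
Proof.
by rewrite /weaving_coef trace_coefN !eqr_oppLR opprK [X in X + _]addrC.
Qed.

Lemma weaving_coefE n (j : int) : 1 < j -> weaving_coef n j = trace_coef n j.
Proof.
move=> j1; rewrite /weaving_coef.
by do 2![case: eqP => [?|_]; first lia]; rewrite !add0r.
Qed.

Lemma weaving_laurent_expansion V (hV : is_jones_polynomial V) (n : nat) : (1 < n)%N ->
  laurent_expansion (V (weaving_knot n)) n n (weaving_coef n).
Proof.
move=> n1.
have top : weaving_coef n n != 0.
  by case: n n1 => // n n1; rewrite weaving_coefE ?trace_coef_top ?signr_eq0 //; lia.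
split=> //.
- lia.
- move=> j hj; wlog j0 : j hj / 0 <= j => [h|].
    case: (lerP 0 j) => j0; first exact: h.
    by rewrite -weaving_coefN h //; lia.
  by rewrite weaving_coefE ?trace_coef_eq0 //; lia.
- by rewrite weaving_coefN.
- rewrite (jones_weaving hV (N := n)) //; last lia.
  rewrite -[RHS]/(laurent_eval _ _ _) 2!laurent_evalD !laurent_eval_delta; try lia.
  by rewrite expr1z exprN1.
Qed.

(** Here [n - 2 > 1], out of reach of [t + t^-1]. *)
Lemma weaving_coef_top2 n : (3 < n)%N ->
  absz (weaving_coef n (n%:Z - 2)) = 'C(n, 2).
Proof.
case: n => [|[|n]] // n3; rewrite (_ : n.+2%:Z - 2 = n); last lia.
rewrite weaving_coefE ?trace_coef_top2; last lia.
by rewrite abszMsign natz.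
Qed.

End TwistNumber.

Theorem theorem5p1 (V : closed_braid -> jones_field)
    (hV : is_jones_polynomial V) (n : nat) (hn : 5 <= n) :
  is_twist_number (V (weaving_knot n)) 2 (n * (n - 1)).
Proof.
exists n, n, (weaving_coef n); split.
  by apply: weaving_laurent_expansion hV _ _; apply: leq_trans hn.
(* By symmetry both ends contribute ['C(n, 2)], and twice this is [n (n - 1)]. *)
have -> : (- n%:Z + 2 = - (n%:Z - 2))%R by rewrite opprB addrC.
rewrite weaving_coefN !weaving_coef_top2 ?(ltnW hn) //.
by rewrite addnn -mul2n -mul_bin_diag bin1 subn1.
Qed.
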